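(* Let $\Gamma_n$ be the Sierpiński graph with the ''Schreier'' labeling. Let $c_n$ be the number of $c$-labeled edges of a uniformly random dimer covering of $\Gamma_n$, with mean $\mu_n$ and standard deviation $\sigma_n$, and let $C_n=(c_n-\mu_n)/\sigma_n$. - For $n$ odd, $C_n$ equals $\sqrt3$ on every covering of type $h^{ab}$, and equals $-\frac1{\sqrt3}$ on every covering of type $f$, $h^{ac}$ or $h^{bc}$. - For $n$ even, $C_n$ equals $-\sqrt3$ on every covering of type $g^{ab}$, and equals $\frac1{\sqrt3}$ on every covering of type $t$, $g^{ac}$ or $g^{bc}$.
   Context: Let $a,b,c$ act on ternary words by the recursive rules, valid for any ternary word $w$: - $a(0w)=1w$, $a(1w)=0w$, $a(2w)=2a(w)$; - $b(0w)=2w$, $b(2w)=0w$, $b(1w)=1b(w)$; - $c(1w)=2w$, $c(2w)=1w$, $c(0w)=0c(w)$. Let $\Sigma_n$ be the loopless graph on $\{0,1,2\}^n$ with one edge labeled $s$ for each unordered pair $\{u,s(u)\}$, $s(u)\ne u$. The elementary triangles are, for $w\in\{0,1,2\}^{n-1}$, the vertices $0w,1w,2w$ with edges $0w$–$1w$ (label $a$), $0w$–$2w$ (label $b$), and $1w$–$2w$ (label $c$). $\Gamma_n$ is obtained from $\Sigma_n$ by contracting all edges not in an elementary triangle, keeping labels. Its corners are: - $0^n$, where an $a$-edge and a $b$-edge meet; - $1^n$, where an $a$-edge and a $c$-edge meet; - $2^n$, where a $b$-edge and a $c$-edge meet. A dimer covering of $\Gamma_n$ is a matching covering every non-corner vertex,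 and - for $n$ odd, covering exactly $0$ or $2$ corners; - for $n$ even, covering exactly $1$ or $3$ corners. A covering is of type: - $f$ if it covers no corner; - $g^{ab}$, $g^{ac}$, $g^{bc}$ if it covers exactly the corner $0^n$, $1^n$, $2^n$ respectively; - $h^{ab}$, $h^{ac}$, $h^{bc}$ if it covers exactly two corners and misses $0^n$, $1^n$, $2^n$ respectively; - $t$ if it covers all three corners. The mean and variance of $c_n$ are $\mu_n=3^{n-1}/4$ and $\sigma_n^2=3/16$. *)

(* Defs.v *)
From HB Require Import structures.
From mathcomp Require Import all_boot all_order all_algebra.
Set Implicit Arguments.
Unset Strict Implicit.
Unset Printing Implicit Defensive.
Import GRing.Theory Num.Theory.
Local Open Scope ring_scope.

Inductive gen := ga | gb | gc.

Definition ord_of_gen (s : gen) : 'I_3 :=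
  match s with ga => 0 | gb => 1 | gc => 2 end.

Definition gen_of_ord (i : 'I_3) : gen :=
  match val i with 0%N => ga | 1%N => gb | _ => gc end.

Lemma ord_of_genK : cancel ord_of_gen gen_of_ord.
Proof. by case. Qed.

HB.instance Definition _ := Finite.copy gen (can_type ord_of_genK).

(* Each generator exchanges two letters; it acts on a word by exchanging them
   at the first position where one of them occurs. *)
Definition letters (s : gen) : 'I_3 * 'I_3 :=
  match s with ga => (0, 1) | gb => (0, 2) | gc => (1, 2) end.

Fixpoint act (s : gen) (w : seq 'I_3) : seq 'I_3 :=
  if w is x :: w' then
    let: (y, z) := letters s in
    if x == y then z :: w' else if x == z then y :: w' else x :: act s w'
  else [::].

Lemma size_act s w : size (act s w) = size w.
Proof.
elim: w => //= x w IHw; case: (letters s) => y z.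
by do 2?case: ifP => _ //=; rewrite IHw.
Qed.

Notation word n := (n.-tuple 'I_3).

Lemma act_tupleP s n (w : word n) : size (act s w) == n.
Proof. by rewrite size_act size_tuple. Qed.

Definition wact s n (w : word n) : word n := Tuple (act_tupleP s w).

(* A labeled edge is a generator together with its set of endpoints. *)
Notation ledge n := (gen * {set word n})%type.

Definition sigma_edges n : {set ledge n} :=
  [set (u.1, [set u.2; wact u.1 u.2]) | u : gen * word n & wact u.1 u.2 != u.2].

Definition elementary_edges n : {set ledge n} :=
  [set (t.1, [set u : word n | tval u \in
                [:: (letters t.1).1 :: tval t.2; (letters t.1).2 :: tval t.2]])
  | t : gen * word n.-1].

Definition contracted n : rel (word n) := fun u v =>
  [exists e in sigma_edges n :\: elementary_edges n, e.2 == [set u; v]].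

(* The vertices of Gamma_n are the classes of words joined by contracted
   edges; its edges are the uncontracted edges of Sigma_n, whose ends are the
   classes of their original endpoints. *)
Definition vertex n (u : word n) : {set word n} :=
  [set v | connect (@contracted n) u v].

Definition gamma_vertices n : {set {set word n}} := [set vertex u | u : word n].

Definition gamma_edges n : {set ledge n} := sigma_edges n :&: elementary_edges n.

Definition ends n (e : ledge n) : {set {set word n}} :=
  [set vertex u | u in e.2].

Definition corner n (x : 'I_3) : {set word n} := vertex [tuple of nseq n x].

(* The corners, named after the labels of the edges which meet there. *)
Definition corner_ab : 'I_3 := 0.
Definition corner_ac : 'I_3 := 1.
Definition corner_bc : 'I_3 := 2.

Definition matching n (D : {set ledge n}) : bool :=
  (D \subset gamma_edges n) &&
  [forall e in D, forall e' in D, (e != e') ==> [disjoint ends e & ends e']].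

Definition covers n (D : {set ledge n}) (V : {set word n}) : bool :=
  [exists e in D, V \in ends e].

Definition covered_corners n (D : {set ledge n}) : {set 'I_3} :=
  [set x | covers D (corner n x)].

Definition dimer_coverings n : {set {set ledge n}} :=
  [set D | [&& matching D,
      [forall V in gamma_vertices n,
         (V \notin [set corner n x | x : 'I_3]) ==> covers D V]
    & #|covered_corners D| \in (if odd n then [:: 0; 2] else [:: 1; 3])%N]].

Definition type_f n : {set {set ledge n}} :=
  [set D in dimer_coverings n | covered_corners D == set0].
Definition type_g n (x : 'I_3) : {set {set ledge n}} :=
  [set D in dimer_coverings n | covered_corners D == [set x]].
Definition type_h n (x : 'I_3) : {set {set ledge n}} :=
  [set D in dimer_coverings n | covered_corners D == [set~ x]].
Definition type_t n : {set {set ledge n}} :=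
  [set D in dimer_coverings n | covered_corners D == [set: 'I_3]].

Definition unif_mean (R : rcfType) (T : finType) (A : {set T}) (X : T -> R) : R :=
  (\sum_(x in A) X x) / #|A|%:R.

Definition unif_sd (R : rcfType) (T : finType) (A : {set T}) (X : T -> R) : R :=
  Num.sqrt (unif_mean A (fun x => (X x - unif_mean A X) ^+ 2)).

Definition c_count (R : rcfType) n (D : {set ledge n}) : R :=
  #|[set e in D | e.1 == gc]|%:R.

Definition c_mean (R : rcfType) n : R := unif_mean (dimer_coverings n) (@c_count R n).

Definition c_sd (R : rcfType) n : R := unif_sd (dimer_coverings n) (@c_count R n).

Definition c_normalized (R : rcfType) n (D : {set ledge n}) : R :=
  (c_count R D - c_mean R n) / c_sd R n.

(* Main.v *)
(* A dimer covering is determined by the set S of words covered by its edges.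
   A non-corner word u is glued to exactly one other word, its partner, which
   has the same first letter, so S is characterized by two linear conditions
   over F_2: each triangle 0w, 1w, 2w meets S in an even number of words, and
   exactly one word of each glued pair lies in S.
   Let s(u) be -1 if u is in S and 1 otherwise. A triangle contributes
   (1 + s(0w) - s(1w) - s(2w)) / 4 to the number of c-edges; on summing over w,
   partners cancel, and c_n = (3^(n-1) + s(0^n) - s(1^n) - s(2^n)) / 4.
   For each letter z the homogeneous system has a solution containing exactly
   the two corners other than z. Adding it to S shows that each corner sign, and
   each product of two of them, averages to 0, which gives mean and variance. *)

Require Import Defs.
From mathcomp Require Import all_boot all_order all_algebra.
From mathcomp Require Import ring.
Set Implicit Arguments.
Unset Strict Implicit.
Unset Printing Implicit Defensive.
Import GRing.Theory Num.Theory.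
Local Open Scope ring_scope.

(** * Letters and the action of the generators *)

Lemma letter_ind (P : 'I_3 -> Prop) : P 0 -> P 1 -> P 2 -> forall x, P x.
Proof.
move=> P0 P1 P2 [[|[|[|//]]] lt_i3]; [move: P0 | move: P1 | move: P2];
by congr P; apply: val_inj.
Qed.

Lemma big_letter (R : nmodType) (F : 'I_3 -> R) : \sum_x F x = F 0 + F 1 + F 2.
Proof.
rewrite !big_ord_recl big_ord0 addr0 addrA.
by congr (F _ + F _ + F _); apply: val_inj.
Qed.

Lemma card_letters (P : pred 'I_3) : #|[set x | P x]| = (P 0%R + P 1%R + P 2%R)%N.
Proof.
rewrite -sum1dep_card big_mkcond [LHS](big_letter (fun x => if P x then 1%N else 0%N)).
by case: (P 0); case: (P 1); case: (P 2).
Qed.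

Definition fixing_gen (x : 'I_3) : gen :=
  match val x with 0%N => gc | 1%N => gb | _ => ga end.

Lemma act_fixing_gen x w : act (fixing_gen x) (x :: w) = x :: act (fixing_gen x) w.
Proof. by elim/letter_ind: x. Qed.

Lemma fixing_gen_uniq s x :
  x != (letters s).1 -> x != (letters s).2 ->
  s = fixing_gen x.
Proof. by case: s; elim/letter_ind: x. Qed.

Lemma actK s : involutive (act s).
Proof.
move=> w; elim: w => //= x w IHw.
by case: s IHw; elim/letter_ind: x => /= IHw; rewrite ?IHw.
Qed.

(** Every letter other than [x] is moved by [fixing_gen x], so a fixed word contains none. *)
Lemma act_fixing_gen_id x w :
  act (fixing_gen x) w = w -> w = nseq (size w) x.
Proof.
elim: w => //= y w IHw.
elim/letter_ind: x IHw; elim/letter_ind: y => //= IHw [eq_w]; by rewrite {1}IHw.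
Qed.

Lemma act_fixing_gen_nseq x k : act (fixing_gen x) (nseq k x) = nseq k x.
Proof. by elim: k => // k IHk; rewrite act_fixing_gen IHk. Qed.

(** * Gluing of words, and the edges and vertices of the contracted graph *)

Definition corner_word m (x : 'I_3) : word m.+1 := [tuple of nseq m.+1 x].

(* The unique generator acting on u beyond its first letter; u is a corner
   exactly when it is its own partner. *)
Definition partner m (u : word m.+1) : word m.+1 := wact (fixing_gen (thead u)) u.

Section Gamma.
Variable m : nat.
Implicit Types (u v : word m.+1) (w : word m) (s : gen) (x y z : 'I_3).
Implicit Types (D : {set ledge m.+1}) (e : ledge m.+1).

Lemma val_partner x w :
  val (partner [tuple of x :: w]) = x :: act (fixing_gen x) w.
Proof. exact: act_fixing_gen. Qed.

Lemma thead_partner u : thead (partner u) = thead u.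
Proof.
case/tupleP: u => x w.
have -> : partner [tuple of x :: w] = [tuple of x :: wact (fixing_gen x) w].
  by apply: val_inj; rewrite val_partner.
by rewrite !theadE.
Qed.

Lemma partnerK : involutive (@partner m).
Proof.
by move=> u; apply: val_inj; rewrite {1}/partner thead_partner /= actK.
Qed.

Lemma partner_corner x : partner (corner_word m x) = corner_word m x.
Proof.
by apply: val_inj; apply: (act_fixing_gen_nseq x m.+1).
Qed.

Lemma partner_id u : partner u = u -> u = corner_word m (thead u).
Proof.
case/tupleP: u => x w; rewrite theadE => /(congr1 val).
rewrite [val (partner _)]val_partner => -[] /act_fixing_gen_id.
rewrite size_tuple => w_x; apply: val_inj => /=; by rewrite w_x.
Qed.

Definition edge s w : ledge m.+1 :=
  (s, [set [tuple of (letters s).1 :: w]; [tuple of (letters s).2 :: w]]).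

Lemma elementary_edgeP e :
  reflect (exists s w, e = edge s w) (e \in elementary_edges m.+1).
Proof.
have edgeE s w : (s, [set u : word m.+1 | tval u \in
                [:: (letters s).1 :: tval w; (letters s).2 :: tval w]]) = edge s w.
  by congr (_, _); apply/setP=> u; rewrite !inE -!val_eqE.
apply: (iffP imsetP) => [[[s w] _ ->]|[s [w ->]]].
  by exists s, w; rewrite -edgeE.
by exists (s, w); rewrite ?inE //= -edgeE.
Qed.

Lemma edge_sigma s w : edge s w \in sigma_edges m.+1.
Proof.
apply/imsetP; exists (s, [tuple of (letters s).1 :: w]).
  by rewrite inE -val_eqE /=; case: s.
congr (_, [set _; _]); apply: val_inj => /=; by case: s.
Qed.

Lemma gamma_edgeP e :
  reflect (exists s w, e = edge s w) (e \in gamma_edges m.+1).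
Proof.
rewrite inE; apply: (iffP andP) => [[_ /elementary_edgeP] //|].
case=> s [w ->]; split; first exact: edge_sigma.
by apply/elementary_edgeP; exists s, w.
Qed.

Lemma in_edge s w x w' :
  ([tuple of x :: w'] \in (edge s w).2) =
  (w' == w) && ((x == (letters s).1) || (x == (letters s).2)).
Proof.
rewrite !inE -!val_eqE /= !eqseq_cons -!val_eqE /=.
by case: (tval w' == tval w); rewrite ?andbF ?andbT.
Qed.

(** A generator exchanging the first letter gives an elementary edge, so every contracted edge comes
    from the generator fixing it. The condition [v != u] excludes loops at corners. *)
Lemma contractedE u v : contracted u v = (v != u) && (v == partner u).
Proof.
apply/exists_inP/andP => [[e]|[v_neq_u /eqP def_v]].
  rewrite !inE => /andP[nelem_e /imsetP[[s a]]]; rewrite inE /= => sa_neq def_e.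
  rewrite {e}def_e /= in nelem_e *.
  have def_s : s = fixing_gen (thead a).
    case/tupleP: a nelem_e {sa_neq} => x w; rewrite theadE => nelem.
    apply: (fixing_gen_uniq); apply: contra nelem => /eqP def_x;
      apply/elementary_edgeP; exists s, w; rewrite /edge {}def_x; congr (_, _).
      congr ([set _; _]); apply: val_inj => /=; by case: s.
    rewrite setUC; congr ([set _; _]); apply: val_inj => /=; by case: s.
  rewrite {s}def_s in sa_neq nelem_e *; rewrite -/(partner a) in sa_neq *.
  move/eqP=> eq_uv.
  have := set21 u v; have := set22 u v; rewrite -eq_uv !inE.
  have u_neq_v : u != v.
    apply: contraNneq sa_neq => eq_u; move: eq_uv; rewrite eq_u setUid => eq_a.
    have := set21 a (partner a); have := set22 a (partner a).
    by rewrite eq_a !inE => /eqP -> /eqP ->.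
  move=> v_in u_in; move: u_neq_v; rewrite eq_sym.
  case/pred2P: v_in => ->; case/pred2P: u_in => ->; rewrite ?eqxx // => -> //=.
  by rewrite partnerK.
exists (fixing_gen (thead u), [set u; partner u]); last by rewrite /= def_v.
rewrite in_setD; apply/andP; split; last first.
  by apply/imsetP; exists (fixing_gen (thead u), u); rewrite ?inE //= -/(partner u) -def_v.
apply/negP=> /elementary_edgeP[s [w [eq_s eq_set]]].
have : u \in (edge s w).2 by rewrite /= -eq_set set21.
case/tupleP: u eq_s {v_neq_u def_v eq_set} => x w'; rewrite theadE in_edge => <-.
by elim/letter_ind: x => /=; rewrite andbF.
Qed.

(** As [partner] is an involution, a path of contracted edges never leaves a word and its
    partner. *)
Lemma vertexE u : vertex u = [set u; partner u].
Proof.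
apply/setP=> v; rewrite !inE; apply/idP/pred2P => [|[->|->]]; last 2 first.
- exact: connect0.
- have [->|neq] := eqVneq (partner u) u; first exact: connect0.
  by apply: connect1; rewrite contractedE neq eqxx.
case/connectP=> p; elim: p u => [|v' p IHp] u /=; first by left.
rewrite contractedE -andbA => /and3P[_ /eqP -> path_p def_v].
by have [->|->] := IHp _ path_p def_v; [right | left; rewrite partnerK].
Qed.

Lemma vertex_eq u v : (vertex u == vertex v) = (v == u) || (v == partner u).
Proof.
apply/eqP/pred2P => [eq_uv|[->|->] //].
  by apply/pred2P; move: (set21 v (partner v)); rewrite -vertexE -eq_uv vertexE !inE.
by rewrite !vertexE partnerK setUC.
Qed.

(** * Dimer coverings as balanced sets of words *)

Definition covered D : {set word m.+1} := \bigcup_(e in D) e.2.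

Lemma coversE D u :
  covers D (vertex u) = (u \in covered D) || (partner u \in covered D).
Proof.
apply/exists_inP/orP => [[e De /imsetP[v ev /eqP]]|].
  by rewrite vertex_eq => /pred2P[] <-; [left|right]; apply/bigcupP; exists e.
case=> /bigcupP[e De eu]; exists e => //; apply/imsetP.
  by exists u.
by exists (partner u); rewrite //; apply/eqP; rewrite vertex_eq eqxx orbT.
Qed.

Lemma covers_corner D x :
  covers D (corner m.+1 x) = (corner_word m x \in covered D).
Proof. by rewrite (coversE D (corner_word m x)) partner_corner orbb. Qed.

Lemma covered_cornersE D :
  covered_corners D = [set x | corner_word m x \in covered D].
Proof. by apply/setP=> x; rewrite !inE covers_corner. Qed.

Lemma noncorner_vertex u :
  (vertex u \notin [set corner m.+1 x | x : 'I_3]) = (partner u != u).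
Proof.
congr (~~ _); apply/imsetP/eqP => [[x _ /eqP]|/partner_id ->]; last first.
  by exists (thead u).
rewrite vertex_eq => /pred2P[|/(congr1 (@partner m))]; last rewrite partnerK.
  by move <-; exact: partner_corner.
by move <-; rewrite !(partner_corner x).
Qed.

Definition matched (S : {set word m.+1}) : {set ledge m.+1} :=
  [set e in gamma_edges m.+1 | e.2 \subset S].

Definition balanced (S : {set word m.+1}) : Prop :=
  (forall w, ~~ (([tuple of 0 :: w] \in S) (+) ([tuple of 1 :: w] \in S)
                 (+) ([tuple of 2 :: w] \in S)))
  /\ (forall u, partner u != u -> (partner u \in S) = (u \notin S)).

(** With three corners this only fixes a parity, so changing the status of two corners preserves
    it. *)
Definition corner_parity (S : {set word m.+1}) : bool :=
  #|[set x | corner_word m x \in S]| \in (if odd m.+1 then [:: 0; 2] else [:: 1; 3])%N.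

Lemma edge_matched S s w :
  (edge s w \in matched S) =
  ([tuple of (letters s).1 :: w] \in S) && ([tuple of (letters s).2 :: w] \in S).
Proof.
rewrite inE subUset !sub1set andb_idl // => _; apply/gamma_edgeP.
by exists s, w.
Qed.

Lemma mem_covered D x w : D \subset gamma_edges m.+1 ->
  reflect (exists2 s, edge s w \in D & (x == (letters s).1) || (x == (letters s).2))
          ([tuple of x :: w] \in covered D).
Proof.
move=> /subsetP sDG; apply: (iffP bigcupP) => [[e De]|[s Ds xs]].
  have /gamma_edgeP[s [w' def_e]] := sDG e De.
  by rewrite {}def_e in De *; rewrite in_edge => /andP[/eqP-> xs]; exists s.
by exists (edge s w); rewrite // in_edge eqxx.
Qed.

Lemma matching_inj D e e' u : matching D -> e \in D -> e' \in D ->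
  u \in e.2 -> (u \in e'.2) || (partner u \in e'.2) -> e = e'.
Proof.
case/andP=> _ /forall_inP disD De De' eu e'u.
have /forall_inP/(_ e' De')/implyP := disD e De.
have [//|neq_e /(_ isT)] := eqVneq e e'.
move/disjointFr=> /(_ (vertex u)); rewrite imset_f // => /(_ isT)/negP[].
case/orP: e'u => e'u; first exact: imset_f.
by apply/imsetP; exists (partner u); rewrite //; apply/eqP; rewrite vertex_eq eqxx orbT.
Qed.

(** Any two of the three letter pairs share a letter, so distinct edges of one triangle would
    meet. *)
Lemma matching_triangle D w s s' : matching D ->
  edge s w \in D -> edge s' w \in D -> s = s'.
Proof.
move=> matD Ds Ds'.
have [x xs xs'] : exists2 x, (x == (letters s).1) || (x == (letters s).2)
                  & (x == (letters s').1) || (x == (letters s').2).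
  by case: s s' {Ds Ds'} => [] []; by [exists 0 | exists 1 | exists 2].
suff [] : edge s w = edge s' w by [].
by apply: (@matching_inj D _ _ [tuple of x :: w]); rewrite // in_edge eqxx ?xs ?xs'.
Qed.

Lemma matching_balanced D : matching D ->
  (forall u, partner u != u -> covers D (vertex u)) -> balanced (covered D).
Proof.
move=> matD covD; have sDG : D \subset gamma_edges m.+1 by case/andP: matD.
split=> [w|u u_neq].
  case: (pickP (fun s => edge s w \in D)) => [s Ds|noD].
    have memE x : ([tuple of x :: w] \in covered D) =
                  (x == (letters s).1) || (x == (letters s).2).
      apply/(mem_covered _ _ sDG)/idP => [[s' Ds']|xs]; last by exists s.
      by rewrite (matching_triangle matD Ds Ds').
    by rewrite !memE; case: s {Ds memE}.
  have memE x : ([tuple of x :: w] \in covered D) = false.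
    by apply/(mem_covered _ _ sDG) => -[s]; rewrite noD.
  by rewrite !memE.
have := covD u u_neq; rewrite coversE.
have [/bigcupP[e De eu] _|//] := boolP (u \in covered D).
(* If the partner were covered too, it would be by the same edge, whose ends have different first
   letters, whereas partners share theirs. *)
apply/bigcupP=> -[e' De' e'u].
have eq_e : e = e' by apply: (matching_inj matD De De' eu); rewrite e'u orbT.
have [s [w def_e]] := gamma_edgeP _ (subsetP sDG _ De).
rewrite -{e' De'}eq_e {e De}def_e in eu e'u; move: u_neq eu e'u.
case/tupleP: u => x w1; have := thead_partner [tuple of x :: w1].
case/tupleP: (partner _) => x' w2; rewrite !theadE => ->.
by rewrite !in_edge => neq /andP[/eqP eq1 _] /andP[/eqP eq2 _]; rewrite eq1 eq2 eqxx in neq.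
Qed.

Lemma dimer_balanced D : D \in dimer_coverings m.+1 ->
  [/\ balanced (covered D), corner_parity (covered D) & matched (covered D) = D].
Proof.
rewrite inE => /and3P[matD /forall_inP covD].
rewrite covered_cornersE => parD; split=> //.
  apply: matching_balanced => // u; rewrite -noncorner_vertex => u_nc.
  by apply: (implyP (covD _ _)); rewrite ?imset_f.
have sDG : D \subset gamma_edges m.+1 by case/andP: matD.
apply/setP=> e; apply/idP/idP => [De|De]; last first.
  by rewrite inE (subsetP sDG _ De) bigcup_sup.
have [s [w def_e]] : exists s w, e = edge s w.
  by apply/gamma_edgeP; move: De; rewrite inE => /andP[].
rewrite {}def_e in De *; move: De; rewrite edge_matched.
(* The edges of [D] covering the two ends of [edge s w] lie in one triangle, hence coincide; the two
   letters then identify this edge as [edge s w]. *)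
case/andP=> /(mem_covered _ _ sDG)[s1 Ds1 s1P] /(mem_covered _ _ sDG)[s2 Ds2].
rewrite -(matching_triangle matD Ds1 Ds2) => s2P; congr (edge _ w \in D): Ds1.
by case: s s1 {Ds2} s1P s2P => [] [].
Qed.

(** By evenness, each word of [S] has a second word of [S] in its triangle, and the edge joining
    them is matched. *)
Lemma covered_matched S : balanced S -> covered (matched S) = S.
Proof.
case=> balS _; apply/setP=> u; apply/bigcupP/idP => [[e]|Su].
  by rewrite inE => /andP[_ /subsetP]; apply.
case/tupleP: u Su => x w Sx.
have [s Ss xs] : exists2 s, edge s w \in matched S
                          & (x == (letters s).1) || (x == (letters s).2).
  have := balS w; elim/letter_ind: x Sx => Sx; rewrite Sx.
  - case S1: (_ \in S); first by exists ga; rewrite // edge_matched Sx S1.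
    by case S2: (_ \in S) => // _; exists gb; rewrite // edge_matched Sx S2.
  - case S1: (_ \in S); first by exists ga; rewrite // edge_matched Sx S1.
    by case S2: (_ \in S) => // _; exists gc; rewrite // edge_matched Sx S2.
  case S1: (_ \in S); first by exists gb; rewrite // edge_matched Sx S1.
  by case S2: (_ \in S) => // _; exists gc; rewrite // edge_matched Sx S2.
by exists (edge s w); rewrite // in_edge eqxx.
Qed.

Lemma matching_matched S : balanced S -> matching (matched S).
Proof.
case=> balS parS; apply/andP; split.
  by apply/subsetP=> e; rewrite inE => /andP[].
apply/forall_inP=> e Se; apply/forall_inP=> e' Se'; apply/implyP=> neq_e.
apply/pred0P=> V /=; apply/andP=> -[/imsetP[u eu ->] /imsetP[v e'v /eqP]].
have subS e1 u1 : e1 \in matched S -> u1 \in e1.2 -> u1 \in S.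
  by rewrite inE => /andP[_ /subsetP]; apply.
(* Two glued words cannot both lie in [S], so edges meeting at a vertex share an actual word. *)
rewrite vertex_eq => def_v; have {def_v} eq_vu : v = u.
  have [eq_u|u_neq] := eqVneq (partner u) u.
    by apply/eqP; move: def_v; rewrite eq_u orbb.
  case/predU1P: def_v => // /eqP def_v.
  by move: (parS u u_neq); rewrite -def_v (subS e') ?(subS e).
rewrite {}eq_vu in e'v.
have /gamma_edgeP[s [w def_e]] : e \in gamma_edges m.+1.
  by move: Se; rewrite inE => /andP[].
have /gamma_edgeP[s' [w' def_e']] : e' \in gamma_edges m.+1.
  by move: Se'; rewrite inE => /andP[].
move: Se Se' neq_e eu e'v; rewrite {}def_e {}def_e' {subS}.
case/tupleP: u => x t; rewrite !in_edge !edge_matched => sS s'S neq_e.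
case/andP=> /eqP eq_w _ /andP[/eqP eq_w' _]; move: neq_e sS s'S (balS t).
(* Both edges lie in one triangle; distinct labels would put all three of its words in [S], an odd
   number. *)
rewrite -{}eq_w -{}eq_w'; case: (eqVneq s s') => [->|]; first by rewrite eqxx.
have [B BE] : exists B, forall x, ([tuple of x :: t] \in S) = B x.
  by exists (fun x => [tuple of x :: t] \in S).
by rewrite !BE; case: s s' => [] [] //=; case: (B 0); case: (B 1); case: (B 2).
Qed.

Lemma matched_dimer S : balanced S -> corner_parity S ->
  matched S \in dimer_coverings m.+1.
Proof.
move=> balS parS; rewrite inE matching_matched //= covered_cornersE covered_matched //.
apply/andP; split=> //.
apply/forall_inP=> _ /imsetP[u _ ->]; apply/implyP; rewrite noncorner_vertex => u_neq.
by rewrite coversE covered_matched //; case: balS => _ ->; rewrite ?orbN.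
Qed.

(* The strand avoiding z joins the other two corners. In the copies of the graph
   indexed by the last letter x <> z it is the strand avoiding the third letter
   - (x + z), computed in Z/3; hence the automaton reads words from the right. *)
Definition strand_step (x : 'I_3) (st : option 'I_3) : option 'I_3 :=
  if st is Some z then if x == z then None else Some (- (x + z)) else None.

Definition strand_state (z : 'I_3) (w : seq 'I_3) : option 'I_3 :=
  foldr strand_step (Some z) w.

Definition strand (z : 'I_3) : {set word m.+1} :=
  [set u | isSome (strand_state z (val u))].

(** A triangle in state [Some y] loses exactly the word starting with [y]; one in state [None]
    misses the strand. *)
Lemma strand_balanced z w :
  ~~ (([tuple of 0 :: w] \in strand z) (+) ([tuple of 1 :: w] \in strand z)
                 (+) ([tuple of 2 :: w] \in strand z)).
Proof.
rewrite !inE /=; case: (strand_state z w) => //= y.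
by elim/letter_ind: y.
Qed.

(** Where it does not give [None], [strand_step x] undoes itself, so survival is unaffected by
    doubling the last letter read. *)
Lemma isSome_strand_step x st :
  isSome (strand_step x (strand_step x st)) = isSome (strand_step x st).
Proof. by case: st => //= z; elim/letter_ind: x; elim/letter_ind: z. Qed.

Lemma strand_partner z u : (partner u \in strand z) = (u \in strand z).
Proof.
case/tupleP: u => x w; rewrite !inE [val (partner _)]val_partner /=.
elim: (tval w) => // y v IHv.
have [<-|neq_xy] := eqVneq x y.
  by rewrite act_fixing_gen /= !isSome_strand_step.
move: neq_xy; rewrite /strand_state {IHv}.
by elim/letter_ind: x; elim/letter_ind: y => //= _;
  case: (foldr _ _ v) => //= t; elim/letter_ind: t.
Qed.

Lemma strand_corner z x : (corner_word m x \in strand z) = (x != z).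
Proof.
rewrite inE /=; elim: m => [|k IHk] /=; first by case: eqP.
by rewrite isSome_strand_step.
Qed.

(** * Switching a covering along a strand *)

Definition switched z D : {set word m.+1} :=
  [set u | (u \in covered D) (+) (u \in strand z)].

Lemma mem_switched z D u :
  (u \in switched z D) = (u \in covered D) (+) (u \in strand z).
Proof. by rewrite inE. Qed.

Definition flip z D : {set ledge m.+1} := matched (switched z D).

(** The strand meets triangles evenly, contains both or neither of two glued words, and contains two
    corners, so balance and corner parity survive the switch. *)
Lemma flip_dimer z D : D \in dimer_coverings m.+1 ->
  flip z D \in dimer_coverings m.+1 /\
  covered (flip z D) = switched z D.
Proof.
case/dimer_balanced=> [[balD parD] cornD _].
have balF : balanced (switched z D).
  split=> [w|u u_neq].
    move: (balD w) (strand_balanced z w); rewrite 3!mem_switched.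
    have [B BE] : exists B, forall x, ([tuple of x :: w] \in covered D) = B x.
      by exists (fun x => [tuple of x :: w] \in covered D).
    have [C CE] : exists C, forall x, ([tuple of x :: w] \in strand z) = C x.
      by exists (fun x => [tuple of x :: w] \in strand z).
    rewrite !BE !CE; case: (B 0); case: (B 1); case: (B 2) => //= _;
    by case: (C 0); case: (C 1); case: (C 2).
  by rewrite 2!mem_switched strand_partner parD // addNb.
split; last exact: covered_matched.
apply: matched_dimer => //; move: cornD; rewrite /corner_parity.
have [B BE] : exists B, forall x, (corner_word m x \in covered D) = B x.
  by exists (fun x => corner_word m x \in covered D).
rewrite !card_letters 3!mem_switched !strand_corner !BE; case: (odd _); elim/letter_ind: z {balF};
by case: (B 0); case: (B 1); case: (B 2).
Qed.

Lemma flipK z : {in dimer_coverings m.+1, involutive (flip z)}.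
Proof.
move=> D dimD; have [_ covF] := flip_dimer z dimD.
have [_ _ {2}<-] := dimer_balanced dimD; rewrite {1}/flip.
by congr (matched _); apply/setP=> u; rewrite mem_switched covF mem_switched -addbA addbb addbF.
Qed.

End Gamma.

(** * Sums cancelled by an involution *)

Lemma sum_involution0 (R : numDomainType) (T : finType) (A : {pred T})
    (f : T -> T) (F : T -> R) :
  {in A, forall a, f a \in A} -> {in A, involutive f} ->
  {in A, forall a, F (f a) = - F a} -> \sum_(a in A) F a = 0.
Proof.
(* Reindexing along [f] makes the sum equal to its opposite. *)
move=> fA fK Ff; apply/eqP; rewrite -eqNr -sumrN; apply/eqP.
rewrite [RHS](reindex_onto f f) //=; apply: eq_big => [a|a /Ff-> //].
apply/idP/andP => [Aa|[Afa /eqP <-]]; last exact: fA.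
by rewrite fA // fK.
Qed.

Lemma sum_word (R : nmodType) m (F : word m.+1 -> R) :
  \sum_u F u = \sum_x \sum_(w : word m) F [tuple of x :: w].
Proof.
rewrite pair_big /= (reindex (fun p : 'I_3 * word m => [tuple of p.1 :: p.2])) //=.
exists (fun u => (thead u, [tuple of behead u])) => [[x w]|u] _.
  by congr (_, _); apply: val_inj.
by rewrite -tuple_eta.
Qed.

(** The words fixed by [partner] are the corner words; all other terms cancel in glued pairs. *)
Lemma sum_partner (R : numDomainType) m (F : word m.+1 -> R) :
  (forall u, partner u != u -> F (partner u) = - F u) ->
  \sum_u F u = \sum_x F (corner_word m x).
Proof.
move=> Fpartner; rewrite (bigID (fun u => partner u == u)) /=.
rewrite [X in _ + X](sum_involution0 (f := @partner m)); first last.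
- by move=> u; apply: Fpartner.
- by move=> u _; apply: partnerK.
- by move=> u; rewrite !unfold_in partnerK eq_sym.
rewrite addr0 (reindex_onto (@corner_word m) (fun u => thead u)) => [|u /eqP/partner_id //].
by apply: eq_bigl => x; rewrite partner_corner eqxx; apply/eqP.
Qed.

(** * Mean and variance of the number of [c]-edges *)

Lemma sqrt3_neq0 (R : rcfType) : Num.sqrt 3 != 0 :> R.
Proof. by apply: lt0r_neq0; rewrite sqrtr_gt0. Qed.

Section Statistics.
Variables (R : rcfType) (m : nat).
Implicit Types D : {set ledge m.+1}.

Definition cover_sign D (u : word m.+1) : R := (-1) ^+ (u \in covered D).

Definition corner_sign x D : R := cover_sign D (corner_word m x).

(** Four times the centred number of [c]-edges, as [c_countE] and [sum_deviation] show. *)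
Definition deviation D : R := corner_sign 0 D - corner_sign 1 D - corner_sign 2 D.

Lemma c_count_sum D : D \subset gamma_edges m.+1 ->
  c_count R D = \sum_(w : word m) (edge gc w \in D)%:R.
Proof.
move/subsetP=> sDG.
have -> : c_count R D = #|edge gc @: [set w | edge gc w \in D]|%:R.
  congr (#|pred_of_set _|%:R); apply/setP=> e; rewrite inE.
  apply/andP/imsetP => [[De /eqP e_c]|[w + ->]]; last by rewrite inE.
  have /gamma_edgeP[s [w def_e]] := sDG e De; rewrite def_e /= in De e_c.
  by exists w; rewrite ?inE -e_c.
(* [edge gc] is injective: the word [1 :: w] lies on no [c]-edge but that of [w]. *)
rewrite card_imset => [|w w' [/setP/(_ [tuple of 1 :: w])]].
  rewrite -sum1dep_card big_mkcond natr_sum; apply: eq_bigr => w _.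
  by case: (edge gc w \in D).
have := in_edge gc w' 1 w; rewrite /= => ->; rewrite !inE eqxx /= andbT.
by move/esym/eqP.
Qed.

Lemma c_countE D : D \in dimer_coverings m.+1 ->
  c_count R D = (3 ^+ m + deviation D) / 4.
Proof.
case/dimer_balanced=> [[balD parD] _ matD].
(* The coefficient depends only on the first letter, which partners share, so the sum over all words
   collapses to the corners. *)
pose coef x : R := if x == 0 :> 'I_3 then 1 else -1.
have -> : deviation D = \sum_(u : word m.+1) coef (thead u) * cover_sign D u.
  rewrite sum_partner => [|u u_neq].
    by rewrite big_letter /= /coef /=; rewrite /deviation /corner_sign; ring.
  by rewrite thead_partner /cover_sign parD // signrN mulrN.
rewrite sum_word big_letter -!big_split /=.
have -> : 3 ^+ m = \sum_(w : word m) 1 :> R.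
  by rewrite big_const iter_addr_0 card_tuple card_ord natrX.
rewrite -big_split /= c_count_sum; last first.
  by rewrite -matD; apply/subsetP=> e; rewrite inE => /andP[].
rewrite mulr_suml; apply: eq_bigr => w _.
rewrite -{1}matD edge_matched /= /coef !theadE /= /cover_sign.
have [B BE] : exists B, forall x, ([tuple of x :: w] \in covered D) = B x.
  by exists (fun x => [tuple of x :: w] \in covered D).
(* Four even patterns remain; only the one covering the words that begin with 1 and 2 has a
   [c]-edge. *)
move: (balD w); rewrite !BE; case: (B 0); case: (B 1); case: (B 2) => //= _;
by rewrite ?expr0 ?expr1; field.
Qed.

Lemma corner_sign_covered x D : corner_sign x D = (-1) ^+ (x \in covered_corners D).
Proof. by rewrite covered_cornersE inE. Qed.

Lemma corner_sign_flip z x D : D \in dimer_coverings m.+1 ->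
  corner_sign x (flip z D) = if x == z then corner_sign x D else - corner_sign x D.
Proof.
move=> dimD; have [_ covF] := flip_dimer z dimD.
rewrite /corner_sign /cover_sign covF mem_switched strand_corner.
by case: (x == z) => /=; rewrite ?addbF ?addbT // signrN.
Qed.

Lemma sum_flip0 z (F : {set ledge m.+1} -> R) :
  {in dimer_coverings m.+1, forall D, F (flip z D) = - F D} ->
  \sum_(D in dimer_coverings m.+1) F D = 0.
Proof.
apply: sum_involution0; last exact: flipK.
by move=> D dimD; case: (flip_dimer z dimD).
Qed.

Lemma sum_corner_sign x : \sum_(D in dimer_coverings m.+1) corner_sign x D = 0.
Proof.
(* Any letter other than [x] would serve: the strand avoiding it contains the corner [x]. *)
apply: (@sum_flip0 (x + 1)) => D dimD; rewrite corner_sign_flip //.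
by elim/letter_ind: x.
Qed.

Lemma sum_corner_sign2 x y : x != y ->
  \sum_(D in dimer_coverings m.+1) corner_sign x D * corner_sign y D = 0.
Proof.
(* The strand avoiding [x] keeps the sign at [x] and reverses the one at [y]. *)
move=> neq_xy; apply: (@sum_flip0 x) => D dimD.
by rewrite !corner_sign_flip // eqxx eq_sym (negPf neq_xy) mulrN.
Qed.

Lemma sum_deviation : \sum_(D in dimer_coverings m.+1) deviation D = 0.
Proof. by rewrite !sumrB !sum_corner_sign !subr0. Qed.

Lemma sum_deviation_sqr :
  \sum_(D in dimer_coverings m.+1) deviation D ^+ 2 = 3 * #|dimer_coverings m.+1|%:R.
Proof.
transitivity (\sum_(D in dimer_coverings m.+1) (3
    + corner_sign 0 D * corner_sign 1 D * (- 2)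
    + corner_sign 0 D * corner_sign 2 D * (- 2)
    + corner_sign 1 D * corner_sign 2 D * 2)).
  apply: eq_bigr => D _.
  have sqr1 x : corner_sign x D ^+ 2 = 1 by rewrite /corner_sign sqrr_sign.
  (* Writing 3 as a sum of squared signs leaves the polynomial expansion of the square. *)
  rewrite (_ : 3 = corner_sign 0 D ^+ 2 + corner_sign 1 D ^+ 2 + corner_sign 2 D ^+ 2).
    by rewrite /deviation; ring.
  by rewrite !sqr1; ring.
rewrite !big_split /= -!mulr_suml !sum_corner_sign2 //.
by rewrite !mul0r !addr0 !sumr_const; ring.
Qed.

Lemma c_normalizedE D : D \in dimer_coverings m.+1 ->
  c_normalized R D = deviation D / Num.sqrt 3.
Proof.
move=> dimD.
have card_neq0 : #|dimer_coverings m.+1|%:R != 0 :> R.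
  by rewrite pnatr_eq0 -lt0n; apply/card_gt0P; exists D.
have meanE : c_mean R m.+1 = 3 ^+ m / 4.
  rewrite /c_mean /unif_mean (eq_bigr _ c_countE) -mulr_suml big_split /=.
  by rewrite sum_deviation sumr_const -mulr_natr; field.
have sdE : c_sd R m.+1 = Num.sqrt 3 / 4.
  rewrite /c_sd /unif_sd -/(c_mean R m.+1) meanE /unif_mean.
  rewrite (eq_bigr (fun D => deviation D ^+ 2 / 16)) => [|D' dimD'].
    rewrite -mulr_suml sum_deviation_sqr.
    (* The variance 3/16 is written with a square factor so that its root splits. *)
    rewrite (_ : _ / _ = 3 * (1 / 4) ^+ 2); last by field.
    by rewrite sqrtrM // sqrtr_sqr ger0_norm ?mul1r // invr_ge0.
  by rewrite c_countE //; field.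
have sqrt3_nz := sqrt3_neq0 R.
by rewrite /c_normalized meanE sdE c_countE //; field.
Qed.

End Statistics.

Theorem theorem5p3 (R : rcfType) (n : nat) (n_gt0 : (0 < n)%N) :
  (odd n ->
    (forall D, D \in type_h n corner_ab ->
       c_normalized R D = Num.sqrt 3) /\
    (forall D, D \in type_f n \/ D \in type_h n corner_ac \/
               D \in type_h n corner_bc ->
       c_normalized R D = - (1 / Num.sqrt 3))) /\
  (~~ odd n ->
    (forall D, D \in type_g n corner_ab ->
       c_normalized R D = - Num.sqrt 3) /\
    (forall D, D \in type_t n \/ D \in type_g n corner_ac \/
               D \in type_g n corner_bc ->
       c_normalized R D = 1 / Num.sqrt 3)).
Proof.
have sqrt3_nz := sqrt3_neq0 R.
have sqrt3E : 3 / Num.sqrt 3 = Num.sqrt 3 :> R.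
  by rewrite -{1}(@sqr_sqrtr R 3) // expr2 mulfK.
(* The value depends only on the set [A] of covered corners, which each type prescribes. *)
have normE k (D : {set ledge k.+1}) (A : {set 'I_3}) :
    (D \in dimer_coverings k.+1) && (covered_corners D == A) ->
    c_normalized R D =
    ((-1) ^+ (0 \in A) - (-1) ^+ (1 \in A) - (-1) ^+ (2 \in A)) / Num.sqrt 3.
  by case/andP=> dimD /eqP <-; rewrite c_normalizedE // /deviation !corner_sign_covered.
case: n n_gt0 => // m _; split=> parity_n; split=> D.
(* The corners 1 and 2 are covered, so the numerator is 3; in the next case it is always -1. *)
- rewrite inE => /normE ->; rewrite !inE /= expr0 expr1 -[RHS]sqrt3E.
  by congr (_ / _); ring.
- by case=> [|[]]; rewrite inE => /normE ->; rewrite !inE /= ?expr0 ?expr1; field.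
(* Only the corner 0 is covered, so the numerator is -3; in the last case it is always 1. *)
- rewrite inE => /normE ->; rewrite !inE /= expr0 expr1 -[in RHS]sqrt3E -mulNr.
  by congr (_ / _); ring.
by case=> [|[]]; rewrite inE => /normE ->; rewrite !inE /= ?expr0 ?expr1; field.
Qed.
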